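(* If $G$ is a connected triangle-free graph and $d\ge 2$ is an integer, then $\mathrm{gp}_d(G)\le\mathrm{diss}(G)$. Moreover, $\mathrm{gp}_2(G)=\mathrm{diss}(G)$.
   Context: Graphs are finite, simple, undirected. $d_G(u,w)$ denotes the shortest-path distance in $G$, and $I_G(u,w)=\{x\in V(G): d_G(u,w)=d_G(u,x)+d_G(x,w)\}$. A set $S\subseteq V(G)$ is a general $d$-position set if for any three distinct vertices $u,v,w\in S$ with $v\in I_G(u,w)$ we have $d_G(u,w)>d$. $\mathrm{gp}_d(G)$ is the cardinality of a largest general $d$-position set of $G$. A set $S\subseteq V(G)$ is a dissociation set if the subgraph of $G$ induced by $S$ has maximum degree at most $1$; the dissociation number $\mathrm{diss}(G)$ is the cardinality of a largest dissociation set in $G$. *)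

(* Defs.v *)
From mathcomp Require Import all_boot.

Set Implicit Arguments.
Unset Strict Implicit.
Unset Printing Implicit Defensive.

(* A finite simple undirected graph is given by a vertex type [T : finType]
   and a symmetric irreflexive adjacency relation [e : rel T]. *)

Section Graphs.

Variables (T : finType) (e : rel T).

Definition connected_graph : Prop := forall x y : T, connect e x y.

Definition triangle_free : Prop :=
  forall x y z : T, ~ [/\ e x y, e y z & e z x].

Definition has_path (n : nat) (x y : T) : bool :=
  [exists p : n.-tuple T, [&& path e x p, uniq (x :: p) & last x p == y]].

(* A path has fewer than #|T| edges, so bounding the length loses nothing;
   #|T| is only the default value when y is not reachable from x. *)
Definition gdist (x y : T) : nat :=
  \big[minn/#|T|]_(n < #|T| | has_path n x y) n.

Definition ginterval (u w : T) : {set T} :=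
  [set x | gdist u w == gdist u x + gdist x w].

Definition general_position (d : nat) (S : {set T}) : bool :=
  [forall u in S, forall v in S, forall w in S,
     [&& u != v, v != w, u != w & v \in ginterval u w] ==> (d < gdist u w)].

Definition gp (d : nat) : nat :=
  \max_(S : {set T} | general_position d S) #|S|.

Definition dissociation_set (S : {set T}) : bool :=
  [forall x in S, #|[set y in S | e x y]| <= 1].

Definition diss : nat :=
  \max_(S : {set T} | dissociation_set S) #|S|.

End Graphs.

(* Main.v *)
Require Import Defs.
From mathcomp Require Import all_boot.
From mathcomp Require Import order.

Set Implicit Arguments.
Unset Strict Implicit.
Unset Printing Implicit Defensive.

(** In a triangle-free graph, two distinct vertices with a common neighbour
    are at distance exactly 2, and that neighbour lies between them.  Hence a
    vertex with two neighbours inside [S] is the middle of a geodesic of length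
    2 in [S], which a general [d]-position set with [2 <= d] excludes: such a
    set is a dissociation set ([general_position_dissociation]).

    Conversely, if [v] lies strictly between [u] and [w] and these are at
    distance at most 2, then both halves of the geodesic have length 1, so [v]
    has the two neighbours [u] and [w].  Hence a dissociation set is a general
    2-position set ([dissociation_general_position]).  Comparing the maxima
    gives the theorem.

    Both directions only use distances up to 2, so all that is needed about
    [gdist] is when it equals 0, 1 or 2. *)

Section Distance.

Variables (T : finType) (e : rel T).
Implicit Types (x y z : T) (n : nat).

Lemma has_path_ltn_card n x y : has_path e n x y -> n < #|T|.
Proof.
case/existsP=> p /and3P[_ up _].
by rewrite -(size_tuple p) -[_.+1]/(size (x :: p)) -(card_uniqP up) max_card.
Qed.

Lemma gdist_leq n x y : has_path e n x y -> gdist e x y <= n.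
Proof.
move=> xyn; have n_lt := has_path_ltn_card xyn.
exact: (@Order.TotalTheory.bigmin_le_cond _ nat _ #|T| (Ordinal n_lt)).
Qed.

(** The default value [#|T|] in [gdist] is larger than the length of any path,
    so a smaller value is the length of an actual one. *)
Lemma gdist_attained x y :
  gdist e x y < #|T| -> has_path e (gdist e x y) x y.
Proof.
rewrite /gdist; elim/big_ind: _ => [|m n IHm IHn|[n n_lt] //=].
  by rewrite ltnn.
by rewrite /minn; case: ifP.
Qed.

Lemma has_path0 x y : has_path e 0 x y = (x == y).
Proof.
apply/existsP/idP => [[p]|xy]; first by rewrite tuple0.
by exists [tuple]; rewrite /= xy.
Qed.

Lemma has_path1 x y : has_path e 1 x y = (x != y) && e x y.
Proof.
apply/existsP/andP => [[p]|[xy exy]].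
  case/tupleP: p => z p; rewrite tuple0 /= inE !andbT.
  by case/and3P=> exz xz /eqP <-.
by exists [tuple y]; rewrite /= inE xy exy eqxx.
Qed.

Lemma gdist_eq0 x y : (gdist e x y == 0) = (x == y).
Proof.
apply/eqP/idP => [xy0|]; last first.
  by rewrite -has_path0 => /gdist_leq; rewrite leqn0 => /eqP.
rewrite -has_path0 -xy0 gdist_attained // xy0.
by apply/card_gt0P; exists x.
Qed.

Lemma gdist_eq1 x y : x != y -> (gdist e x y == 1) = e x y.
Proof.
move=> xy; apply/eqP/idP => [xy1|exy].
  have: has_path e 1 x y.
    rewrite -xy1 gdist_attained // xy1.
    by apply/card_gt1P; exists x, y.
  by rewrite has_path1 => /andP[].
apply/eqP; rewrite eqn_leq lt0n gdist_eq0 xy andbT.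
by apply: gdist_leq; rewrite has_path1 xy.
Qed.

Lemma gdist_eq2 x y z :
  irreflexive e -> x != z -> ~~ e x z -> e x y -> e y z -> gdist e x z = 2.
Proof.
move=> e_irr xz nexz exy eyz.
have xy: x != y by apply: contraTneq exy => ->; rewrite e_irr.
have yz: y != z by apply: contraTneq eyz => ->; rewrite e_irr.
have: gdist e x z <= 2.
  apply: gdist_leq; apply/existsP; exists [tuple y; z].
  by rewrite /= !inE negb_or xy xz yz exy eyz eqxx.
have := gdist_eq0 x z; have := gdist_eq1 xz.
by rewrite (negbTE xz) (negbTE nexz); case: gdist => [|[|[]]].
Qed.

End Distance.

Section Comparison.

Variables (T : finType) (e : rel T).
Hypotheses (e_sym : symmetric e) (e_irr : irreflexive e).
Implicit Types S : {set T}.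

Lemma adj_neq x y : e x y -> x != y.
Proof. by apply: contraTneq => ->; rewrite e_irr. Qed.

Lemma general_position_dissociation d S :
  triangle_free e -> 2 <= d -> general_position e d S -> dissociation_set e S.
Proof.
move=> e_tf d_ge2 gpS; apply/forall_inP=> v vS.
rewrite leqNgt; apply/negP=> /card_gt1P[u [w []]].
rewrite !inE => /andP[uS evu] /andP[wS evw] uw.
have euv: e u v by rewrite e_sym.
have neuw: ~~ e u w.
  by apply/negP=> euw; apply: (e_tf u w v); split; rewrite // e_sym.
have uw2 := gdist_eq2 e_irr uw neuw euv evw.
have uv1: gdist e u v = 1 by apply/eqP; rewrite gdist_eq1 ?adj_neq.
have vw1: gdist e v w = 1 by apply/eqP; rewrite gdist_eq1 ?adj_neq.
move/forall_inP/(_ u uS)/forall_inP/(_ v vS)/forall_inP/(_ w wS): gpS.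
by rewrite (adj_neq euv) (adj_neq evw) uw inE uw2 uv1 vw1 /= ltnNge d_ge2.
Qed.

Lemma dissociation_general_position S :
  dissociation_set e S -> general_position e 2 S.
Proof.
move=> /forall_inP dissS.
apply/forall_inP=> u uS; apply/forall_inP=> v vS; apply/forall_inP=> w wS.
apply/implyP=> /and4P[uv vw uw]; rewrite inE => /eqP uvw.
rewrite ltnNge; apply: contraL (dissS v vS) => uw_le2; rewrite -ltnNge.
have [euv evw]: e u v /\ e v w.
  rewrite -(gdist_eq1 e uv) -(gdist_eq1 e vw).
  move: uv vw uw_le2; rewrite -!(gdist_eq0 e) uvw.
  by case: (gdist e u v) (gdist e v w) => [|[|[|m]]] [|[|[|n]]].
by apply/card_gt1P; exists u, w; rewrite !inE uS wS evw e_sym euv.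
Qed.

End Comparison.

Theorem corollary5p4 (T : finType) (e : rel T)
    (e_sym : symmetric e) (e_irr : irreflexive e)
    (e_conn : connected_graph e) (e_tf : triangle_free e) :
  (forall d : nat, 2 <= d -> gp e d <= diss e) /\ gp e 2 = diss e.
Proof.
have gp_le d : 2 <= d -> gp e d <= diss e.
  move=> d_ge2; apply/bigmax_leqP=> S gpS.
  exact/leq_bigmax_cond/(general_position_dissociation e_sym e_irr e_tf d_ge2).
split=> //; apply/eqP; rewrite eqn_leq gp_le //=.
apply/bigmax_leqP=> S dissS.
exact/leq_bigmax_cond/dissociation_general_position.
Qed.
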